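(* Let $\mathbb{L}$ be the alternate lattice, i.e. the directed graph with vertex set $\mathbb{Z}^2$ in which $(\mathbf{u},\mathbf{v})$ is a directed edge from $\mathbf{u}=(u_1,u_2)$ to $\mathbf{v}=(v_1,v_2)$ if and only if either $v_1=u_1$ and $v_2=u_2\pm 1$, or $v_2=u_2$ and $v_1=u_1+(-1)^{u_2}$. Then the simple random walk on $\mathbb{L}$ is recurrent.
   Context: The simple random walk on a directed graph with vertex set $\mathbb{V}$ and edge set $\mathbb{A}\subseteq \mathbb{V}\times\mathbb{V}$ (no loops, no multiple edges, finite out-degrees) is the $\mathbb{V}$-valued Markov chain $(\mathbf{M}_n)_{n\in\mathbb{N}}$ with transition probabilities $P_{\mathbf{u},\mathbf{v}}=\mathbb{P}(\mathbf{M}_{n+1}=\mathbf{v}\mid \mathbf{M}_n=\mathbf{u})=1/d^-_{\mathbf{u}}$ if $(\mathbf{u},\mathbf{v})\in\mathbb{A}$ and $0$ otherwise, where $d^-_{\mathbf{u}}=\mathrm{card}\{\mathbf{v}:(\mathbf{u},\mathbf{v})\in\mathbb{A}\}$ is the out-degree of $\mathbf{u}$. In the lattice considered here $d^-_{\mathbf{u}}=3$ for every $\mathbf{u}$: vertical moves are allowed in both directions, while each horizontal line $y$ is one-way in the direction $\epsilon_y=(-1)^y$. Recurrent is meant in the usual sense for Markov chains: started from any vertex, the chain returns to that vertex with probability $1$. *)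

(* Defs.v *)
From mathcomp Require Import all_boot all_order all_algebra finmap.
From mathcomp Require Import all_classical all_reals all_analysis.

Set Implicit Arguments.
Unset Strict Implicit.
Unset Printing Implicit Defensive.

Import Order.TTheory GRing.Theory Num.Theory.

Local Open Scope classical_set_scope.
Local Open Scope ring_scope.

Record digraph (V : countType) := Digraph {
  edge :> rel V;
  edge_irreflexive : irreflexive edge;
  finite_out_neighbours : forall u, finite_set [set v | edge u v] }.

Definition outdegree (V : countType) (G : digraph V) (u : V) : nat :=
  #|` fset_set [set v | G u v]|%fset.

Definition srw_transition (R : realType) (V : countType) (G : digraph V)
    (u v : V) : R :=
  if G u v then (outdegree G u)%:R^-1 else 0.

(* Only meaningful when [B] is an event of positive probability. *)
Definition cond_prob (R : realType) (d : measure_display)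
    (T : measurableType d) (P : probability T R) (A B : set T) : R :=
  fine (P (A `&` B)) / fine (P B).

Definition history (T : Type) (V : Type) (M : nat -> T -> V) (x : nat -> V)
    (n : nat) : set T :=
  [set t | forall k, (k <= n)%N -> M k t = x k].

(* [V] carries the discrete sigma-algebra, hence all subsets [B] are tested in
   the measurability clause.  The initial law is left arbitrary. *)
Definition markov_chain (R : realType) (V : countType) (p : V -> V -> R)
    (d : measure_display) (T : measurableType d) (P : probability T R)
    (M : nat -> T -> V) : Prop :=
  (forall n (B : set V), measurable (M n @^-1` B)) /\
  (forall n (x : nat -> V) (v : V),
     (0 < P (history M x n))%E ->
     cond_prob P [set t | M n.+1 t = v] (history M x n) = p (x n) v).

Definition recurrent (R : realType) (V : countType) (p : V -> V -> R) : Prop :=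
  forall (d : measure_display) (T : measurableType d) (P : probability T R)
    (M : nat -> T -> V) (u : V),
  markov_chain p P M ->
  P [set t | M 0%N t = u] = 1%E ->
  P [set t | exists2 n, (0 < n)%N & M n t = u] = 1%E.

(* [(-1) ^ u.2] is exponentiation by a possibly negative integer. *)
Definition alternate_edge (u v : int * int) : bool :=
  (v.1 == u.1) && ((v.2 == u.2 + 1) || (v.2 == u.2 - 1)) ||
  (v.2 == u.2) && (v.1 == u.1 + (-1) ^ u.2).

Lemma alternate_edge_irreflexive : irreflexive alternate_edge.
Proof.
have eqD (x y : int) : (x == x + y) = (y == 0).
  by rewrite -subr_eq0 opprD addrA subrr add0r oppr_eq0.
by move=> [a b]; rewrite /alternate_edge /= !eqxx !eqD /= (negPf (expfz_neq0 _ _)).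
Qed.

Lemma finite_alternate_out_neighbours u :
  finite_set [set v | alternate_edge u v].
Proof.
apply: (@sub_finite_set _ _
  [set` [:: (u.1, u.2 + 1); (u.1, u.2 - 1); (u.1 + (-1) ^ u.2, u.2)]]);
  last exact: finite_seq.
case: u => a b [c e] /=; rewrite /alternate_edge /= !inE !xpair_eqE.
by case/orP => [/andP[-> /orP[]->]|/andP[-> ->]]; rewrite ?orbT.
Qed.

Definition alternate_lattice : digraph (int * int)%type :=
  Digraph alternate_edge_irreflexive finite_alternate_out_neighbours.

(* Main.v *)
(* With e = (-1)^y the process x + e / 4 is a martingale.  In the coordinate
   a = 4 e x + 1 each step of the walk sends (a, y) to (a + 4, y) or
   (2 - a, y +- 1); the form Q = a^2 + 12 y^2 has mean increment 16, and its
   values Q1, Q2, Q3 at the three successors satisfy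
     Q1 Q2 Q3 = Q^3 + 4096 + 512 a^3 - 384 a Q,
   so ln Q is superharmonic up to an error of order Q^(-3/2).  The concave
   function ln (1 + ln Q) gains a term of order 1 / (Q (ln Q)^2), which absorbs
   this error: it is strictly superharmonic away from the origin and tends to
   infinity.  By the maximum principle, the probability of never meeting u then
   attains its maximum over all starting points in a finite set, and strong
   connectedness propagates that maximum to u. *)
Require Import Defs.
From mathcomp Require Import all_boot all_order all_algebra finmap.
From mathcomp Require Import all_classical all_reals all_analysis.
From mathcomp Require Import ring lra zify.

Import Order.TTheory GRing.Theory Num.Theory numFieldNormedType.Exports.

Set Implicit Arguments.
Unset Strict Implicit.
Unset Printing Implicit Defensive.

Local Open Scope classical_set_scope.
Local Open Scope ring_scope.

(** * Means over out-neighbours, avoidance probabilities and the maximum principle *)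

Definition out_nbrs (V : countType) (G : digraph V) (u : V) : {fset V} :=
  fset_set [set v | G u v].

(** The transition operator of the simple random walk, applied to [f]. *)
Definition out_mean (R : realType) (V : countType) (G : digraph V)
    (f : V -> R) (u : V) : R :=
  (\sum_(v <- out_nbrs G u) f v) / (outdegree G u)%:R.

(* Probability that the walk started at the last argument is not at [u] at any
   of the times [1, ..., n]. *)
Fixpoint avoid_prob (R : realType) (V : countType) (G : digraph V) (u : V)
    (n : nat) : V -> R :=
  if n is m.+1 then
    out_mean G (fun v => if v == u then 0 else avoid_prob R G u m v)
  else fun=> 1.

(** Reachability in closed-set form: taking for [S] the set of vertices reachable from [v] yields a
    directed path from [v] to [w]. *)
Definition strongly_connected (V : countType) (G : digraph V) : Prop :=
  forall S : set V, (forall v w, S v -> G v w -> S w) ->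
  forall v w, S v -> S w.

Section OutMean.
Variables (R : realType) (V : countType) (G : digraph V).
Implicit Types (f g : V -> R) (u v : V).

Lemma in_out_nbrs u v : (v \in out_nbrs G u) = G u v.
Proof.
rewrite /out_nbrs in_fset_set; last exact: finite_out_neighbours.
by apply/idP/idP; rewrite inE.
Qed.

Lemma le_out_mean f g u :
  (forall v, G u v -> f v <= g v) -> out_mean G f u <= out_mean G g u.
Proof.
move=> fg; apply: ler_wpM2r; first by rewrite invr_ge0.
rewrite big_seq [leRHS]big_seq.
by apply: ler_sum => v; rewrite in_out_nbrs => /fg.
Qed.

Lemma out_meanD f g u :
  out_mean G (fun v => f v + g v) u = out_mean G f u + out_mean G g u.
Proof. by rewrite /out_mean big_split mulrDl. Qed.

Lemma out_meanZ (c : R) f u :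
  out_mean G (fun v => c * f v) u = c * out_mean G f u.
Proof. by rewrite /out_mean mulrA mulr_sumr. Qed.

Lemma out_mean_cst (c : R) u : (0 < outdegree G u)%N ->
  out_mean G (fun=> c) u = c.
Proof.
move=> d0; rewrite /out_mean big_const_seq iter_addr_0 count_predT.
by rewrite -[c *+ _]mulr_natr -mulrA divff ?mulr1 // pnatr_eq0 -lt0n.
Qed.

Lemma cvg_out_mean (F : nat -> V -> R) f u :
  (forall v, F ^~ v @ \oo --> f v) ->
  (fun n => out_mean G (F n) u) @ \oo --> out_mean G f u.
Proof.
move=> Ff; apply: cvgM; last exact: cvg_cst.
by apply: cvg_big => [|v _]; [exact: add_continuous|exact: Ff].
Qed.

(* If a bounded subharmonic function attained its maximum only at infinity,
   subtracting a small multiple of [f] would produce a strictly subharmonic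
   function with an interior maximum. *)
Lemma bounded_subharmonic_le0 (F : seq V) f (u : V) (e : V -> R) (B : R) :
  (forall v, 0 < outdegree G v)%N ->
  strongly_connected G ->
  (forall v, 0 <= f v) ->
  (forall c, finite_set [set v | f v <= c]) ->
  (forall v, v \notin F -> out_mean G f v < f v) ->
  (forall v, e v <= B) -> e u = 0 ->
  (forall v, v != u -> e v <= out_mean G e v) ->
  forall v, e v <= 0.
Proof.
move=> deg conn f0 ffin fF eB eu esub.
have exmax (g : V -> R) x (s : seq V) :
    exists2 z, z \in x :: s & forall y, y \in x :: s -> g y <= g z.
  elim: s x => [|y s IH] x.
    by exists x; rewrite ?mem_head// => y; rewrite inE => /eqP->.
  have [z zs zmax] := IH y.
  have [xz|zx] := leP (g x) (g z).
    exists z; first by rewrite inE zs orbT.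
    by move=> t; rewrite inE => /predU1P[->//|/zmax].
  exists x; first exact: mem_head.
  move=> t; rewrite inE => /predU1P[->//|/zmax tz]; exact: le_trans tz (ltW zx).
(* Having [u] among the candidates forces [m >= 0]. *)
have [z zF zmax] := exmax e u F.
set m := e z in zmax.
have m0 : 0 <= m by rewrite -eu; apply: zmax; exact: mem_head.
have em_delta v d : 0 < d -> e v <= m + d * f v.
  move=> d0; rewrite leNgt; apply/negP => vgt.
  set w := fun v => e v - m - d * f v.
  have wv : 0 < w v by rewrite /w; lra.
  (* Where [f > B / d], the function [w] is negative, because [e <= B] and [m >= 0]; a maximum over
     [v] and this finite sublevel set is therefore global. *)
  have [t tD tmax] := exmax w v (fset_set [set v | f v <= B / d]).
  have wt : 0 < w t by apply: lt_le_trans wv _; apply: tmax; exact: mem_head.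
  have tglob y : w y <= w t.
    have [fy|fy] := leP (f y) (B / d).
      apply: tmax; rewrite inE; apply/orP; right.
      by rewrite in_fset_set//; apply/mem_set.
    move: fy; rewrite ltr_pdivrMr// => fy.
    apply: le_trans (ltW wt); rewrite /w; have := eB y; lra.
  have dft : 0 <= d * f t by rewrite mulr_ge0 // ltW.
  (* On [u :: F] one has [e <= m], hence [w <= 0 < w t]; so [t] lies where [w] is strictly
     subharmonic, which contradicts its maximality. *)
  have tnF : t \notin u :: F.
    by apply/negP => /zmax; move: wt; rewrite /w; lra.
  move: tnF; rewrite inE negb_or => /andP[tu tF].
  have : out_mean G w t <= w t.
    rewrite -[leRHS](@out_mean_cst _ t) //.
    by apply: le_out_mean => y _; exact: tglob.
  have -> : out_mean G w t = out_mean G e t - m - d * out_mean G f t.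
    rewrite -mulNr -out_meanZ -[in RHS](@out_mean_cst (- m) t) // -!out_meanD.
    by congr out_mean; apply/funext => y; rewrite /w mulNr.
  have := esub _ tu; have := fF _ tF; rewrite -(ltr_pM2l d0) /w; lra.
have em v : e v <= m.
  apply/ler_addgt0Pr => eps eps0.
  have f1 : 0 < f v + 1 by rewrite ltr_wpDl.
  apply: le_trans (em_delta v (eps / (f v + 1)) _) _; first by rewrite divr_gt0.
  by rewrite lerD2l -mulrAC ler_pdivrMr// ler_pM2l// lerDl.
suff m_le0 : m <= 0 by move=> v; exact: le_trans (em v) m_le0.
rewrite leNgt; apply/negP => mgt0.
(* If [m > 0], the level set of [m] misses [u], so a mean of values at most [m] equals [m] on it:
   the set is closed under edges and would have to reach [u]. *)
have closed v w : e v = m -> G v w -> e w = m.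
  move=> evm Gvw; apply/eqP; rewrite eq_le em /= leNgt; apply/negP => ewm.
  have vu : v != u by apply: contra_ltN mgt0 => /eqP vu; rewrite -evm vu eu.
  suff : out_mean G e v < m by rewrite ltNge -evm esub.
  rewrite /out_mean ltr_pdivrMr ?ltr0n//.
  rewrite -[m](@out_mean_cst m v)// /out_mean divfK ?pnatr_eq0 -?lt0n//.
  have wN : w \in out_nbrs G v by rewrite in_out_nbrs.
  rewrite (big_fsetD1 w)//= [ltRHS](big_fsetD1 w)//= ltr_leD//.
  by apply: ler_sum => y _; exact: em.
have := conn [set v | e v = m] closed z u erefl.
by rewrite /= eu => m0'; rewrite -m0' ltxx in mgt0.
Qed.

Lemma avoid_prob_ge0 u n v : 0 <= avoid_prob R G u n v.
Proof.
elim: n v => [|n IH] v //=; rewrite divr_ge0 // sumr_ge0 // => w _.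
by case: ifP.
Qed.

Lemma avoid_prob_nonincreasing u v : (forall w, 0 < outdegree G w)%N ->
  {homo (fun n => avoid_prob R G u n v) : m n / (m <= n)%N >-> n <= m}.
Proof.
move=> deg; apply/nonincreasing_seqP => n; elim: n v => [|n IH] v.
  rewrite [leRHS](_ : _ = 1) // -(@out_mean_cst 1 v) //.
  by apply: le_out_mean => w _; case: ifP.
apply: le_out_mean => w _; case: ifP => // _; exact: IH.
Qed.

(** The limit [q] satisfies [q = out_mean G e], where [e] is [q] reset to 0 at [u]. Thus [e] is
    harmonic off [u] and bounded by 1, and the maximum principle gives [e <= 0]; then [q <= 0]
    everywhere, also at [u]. *)
Lemma cvg_avoid_prob0 (F : seq V) f (u v : V) :
  (forall v, 0 < outdegree G v)%N ->
  strongly_connected G ->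
  (forall v, 0 <= f v) ->
  (forall c, finite_set [set v | f v <= c]) ->
  (forall v, v \notin F -> out_mean G f v < f v) ->
  avoid_prob R G u ^~ v @ \oo --> (0 : R).
Proof.
move=> deg conn f0 ffin fF.
have cv w : cvgn (avoid_prob R G u ^~ w).
  apply: nonincreasing_is_cvgn; first exact: avoid_prob_nonincreasing.
  by exists 0 => _ [n _ <-]; exact: avoid_prob_ge0.
pose q w := limn (avoid_prob R G u ^~ w).
pose e w := if w == u then 0 else q w.
have qE w : q w = out_mean G e w.
  have : (fun n => avoid_prob R G u n.+1 w) @ \oo --> out_mean G e w.
    apply: cvg_out_mean => t; rewrite /e; case: ifP => _; first exact: cvg_cst.
    exact: cv.
  move=> /(cvg_lim (@norm_hausdorff _ _)) <-; apply/esym/cvg_lim => //.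
  by rewrite (cvg_shiftS (avoid_prob R G u ^~ w)); exact: cv.
have qle1 w : q w <= 1.
  have noninc := avoid_prob_nonincreasing u w deg.
  by have := nonincreasing_cvgn_ge noninc (cv w) 0%N.
have e_le0 : forall w, e w <= 0.
  apply: (bounded_subharmonic_le0 (F := F) (f := f) (u := u) (B := 1)) => //.
  - by move=> w; rewrite /e; case: ifP.
  - by rewrite /e eqxx.
  - by move=> w wu; rewrite -qE /e (negPf wu).
suff -> : 0 = q v by exact: cv.
apply/eqP; rewrite eq_le; apply/andP; split.
  by apply: limr_ge => //; apply: nearW => n; exact: avoid_prob_ge0.
by rewrite qE -[leRHS](@out_mean_cst 0 v)//; exact: le_out_mean.
Qed.

End OutMean.

(** * From avoidance probabilities to almost sure return of a Markov chain *)

Section MarkovChain.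
Variables (R : realType) (V : countType) (G : digraph V).
Variables (d : measure_display) (T : measurableType d) (P : probability T R).
Variable M : nat -> T -> V.
Hypothesis deg : forall v, (0 < outdegree G v)%N.
Hypothesis chain : markov_chain (@srw_transition R V G) P M.

Let measM n (B : set V) : measurable (M n @^-1` B).
Proof. exact: chain.1. Qed.

Lemma measurable_history x n : measurable (history M x n).
Proof.
rewrite (_ : history M x n =
  \bigcap_k (if (k <= n)%N then M k @^-1` [set x k] else setT)).
  by apply: bigcap_measurableType => k _; case: ifP => // _; exact: measM.
apply/seteqP; split => t /=.
  by move=> xt k _ /=; case: ifP => // /xt.
by move=> xt k kn; have := xt k I; rewrite kn.
Qed.

Let avoided (u : V) (n m : nat) : set T :=
  [set t | forall k, (n < k <= n + m)%N -> M k t <> u].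

Lemma measurable_avoided u n m : measurable (avoided u n m).
Proof.
rewrite (_ : avoided u n m = \bigcap_k
  (if (n < k <= n + m)%N then M k @^-1` [set v | v <> u] else setT)).
  by apply: bigcap_measurableType => k _; case: ifP => // _; exact: measM.
apply/seteqP; split => t /=.
  by move=> ut k _ /=; case: ifP => // /ut.
by move=> ut k kn; have := ut k I; rewrite kn.
Qed.

(** Product form of the Markov property; it extends to histories of probability 0, where both sides
    vanish. *)
Lemma measure_next_step x n v :
  P (history M x n `&` [set t | M n.+1 t = v]) =
  (P (history M x n) * (srw_transition R G (x n) v)%:E)%E.
Proof.
have mH := measurable_history x n.
have mv : measurable [set t | M n.+1 t = v] := measM n.+1 [set v].
have := measure_ge0 P (history M x n); rewrite le_eqVlt => /predU1P[H0|Hpos].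
  rewrite -H0 mul0e; apply: subset_measure0 (esym H0) => //.
  exact: measurableI.
have := chain.2 n x v Hpos; rewrite /cond_prob => <-.
rewrite setIC -[in RHS](fineK (fin_num_measure P _ mH)) -EFinM mulrCA divff.
  by rewrite mulr1 fineK // fin_num_measure //; exact: measurableI.
by rewrite gt_eqF // fine_gt0 // Hpos ltey_eq fin_num_measure.
Qed.

(** The transition probabilities to the out-neighbours add up to 1, so after a given history the
    chain moves elsewhere only on a null set. *)
Lemma measure_out_nbrs_split x n E : measurable E -> E `<=` history M x n ->
  P E = (\sum_(v <- out_nbrs G (x n)) P (E `&` [set t | M n.+1 t = v]))%E.
Proof.
set N := out_nbrs G (x n); set W := [set t | M n.+1 t \in N].
have mW : measurable W := measM n.+1 [set v | v \in N].
have mv v : measurable [set t | M n.+1 t = v] := measM n.+1 [set v].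
have inN A : measurable A ->
    P (A `&` W) = (\sum_(v <- N) P (A `&` [set t | M n.+1 t = v]))%E.
  move=> mA; rewrite -measure_fbigsetU.
  - congr (P _); rewrite -bigcup_fset; apply/seteqP; split => t /=.
      by move=> [At Wt]; exists (M n.+1 t).
    by move=> [v vN [At tv]]; split; rewrite /W /= ?tv.
  - by move=> v _; exact: measurableI.
  - by move=> v w _ _ [t [[_ /= <-] [_ /= <-]]].
move=> mE EH; rewrite -inN //.
have mH := measurable_history x n.
have PHW : P (history M x n `\` W) = 0%E.
  rewrite measureD //; last by rewrite ltey_eq fin_num_measure.
  rewrite [X in (_ - X)%E](_ : _ = P (history M x n)).
    by rewrite subee // fin_num_measure.
  apply: (etrans (inN _ mH)); rewrite (eq_bigr (fun v => P (history M x n) *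
    (srw_transition R G (x n) v)%:E)%E); last first.
    by move=> v _; rewrite measure_next_step.
  rewrite -fin_num_sume_distrr; first last.
  - by move=> v w _ _; exact: fin_num_adde_defr.
  - exact: fin_num_measure.
  rewrite sumEFin big_seq (eq_bigr (fun=> (outdegree G (x n))%:R^-1)).
    rewrite -big_seq big_const_seq iter_addr_0 count_predT.
    rewrite -[_^-1 *+ _]mulr_natl divff.
      by rewrite mule1.
    by rewrite pnatr_eq0 -lt0n; exact: deg.
  by move=> v; rewrite /srw_transition in_out_nbrs => ->.
rewrite (measureDI P mE mW) [X in (X + _)%E](_ : _ = 0%E) ?add0e //.
apply: subset_measure0 PHW; [exact: measurableD|exact: measurableD|].
exact: setSD.
Qed.

(** Induction on [m] for all [n] and [x], splitting by the next step: a step to [u] contributes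
    nothing, and a step to [v] lengthens the history by [v]. *)
Lemma measure_avoided_le u m n x :
  (P (history M x n `&` avoided u n m) <=
   P (history M x n) * (avoid_prob R G u m (x n))%:E)%E.
Proof.
elim: m n x => [|m IH] n x.
  rewrite mule1; apply: measureIl; first exact: measurable_history.
  exact: measurable_avoided.
have mH := measurable_history x n.
have mE := measurableI _ _ mH (measurable_avoided u n m.+1).
have mv v : measurable [set t | M n.+1 t = v] := measM n.+1 [set v].
rewrite (@measure_out_nbrs_split x n)//.
have -> : (P (history M x n) * (avoid_prob R G u m.+1 (x n))%:E =
   \sum_(v <- out_nbrs G (x n)) P (history M x n `&` [set t | M n.+1 t = v]) *
     (if v == u then 0 else avoid_prob R G u m v)%:E)%E.
  rewrite /= /out_mean mulr_suml -sumEFin fin_num_sume_distrr; first last.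
  - by move=> v w _ _; exact: fin_num_adde_defr.
  - exact: fin_num_measure.
  rewrite big_seq [RHS]big_seq; apply: eq_bigr => v vN.
  rewrite measure_next_step /srw_transition -in_out_nbrs vN.
  by rewrite -muleA -EFinM mulrC.
apply: lee_sum => v _; have [->|/eqP vu] := eqVneq v u.
  rewrite mule0 (_ : _ `&` _ = set0) ?measure0//.
  apply/seteqP; split => // t [[_ ut] /= tu]; apply: (ut n.+1) tu.
  by rewrite ltnSn addnS ltnS leq_addr.
pose x' k := if k == n.+1 then v else x k.
have Hx' : history M x' n.+1 = history M x n `&` [set t | M n.+1 t = v].
  apply/seteqP; split => t /=.
    move=> tx; split; last by rewrite (tx n.+1)// /x' eqxx.
    by move=> k kn; rewrite tx ?(leqW kn)// /x' ltn_eqF.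
  move=> [tx tv] k; rewrite leq_eqVlt /x' => /predU1P[->|kn].
    by rewrite eqxx.
  by rewrite ltn_eqF// tx.
have := IH n.+1 x'; rewrite Hx' /x' eqxx; apply: le_trans.
apply: le_measure; rewrite ?inE.
- exact: measurableI.
- apply: measurableI; last exact: measurable_avoided.
  exact: measurableI.
- move=> t [[tx ut] tv]; split; first by split.
  by move=> k /andP[nk km]; apply: ut; rewrite (ltnW nk) addnS -addSn.
Qed.

(** Up to the null event of not starting at [u], never returning implies avoiding [u] during the
    times 1 to [n], for every [n]; its probability is thus below a sequence tending to 0. *)
Lemma return_prob1 u :
  avoid_prob R G u ^~ u @ \oo --> (0 : R) ->
  P [set t | M 0%N t = u] = 1%E ->
  P [set t | exists2 n, (0 < n)%N & M n t = u] = 1%E.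
Proof.
move=> cvg0 P0.
set B := [set t | _].
have mB : measurable B.
  rewrite (_ : B = \bigcup_n (M n.+1 @^-1` [set u])).
    by apply: bigcup_measurable => n _; exact: measM.
  apply/seteqP; split => t; first by move=> [[//|n] _ tu]; exists n.
  by move=> [n _ tu]; exists n.+1.
have m0 : measurable [set t | M 0%N t = u] := measM 0 [set u].
suff PB0 : P (~` B) = 0%E.
  by rewrite -[B]setCK probability_setC ?PB0 ?sube0//; exact: measurableC.
have mBC : measurable (~` B) by exact: measurableC.
have Ple n : (P (~` B) <= (avoid_prob R G u n u)%:E)%E.
  rewrite (measureDI P mBC m0) [X in (X + _)%E](_ : _ = 0%E).
    rewrite add0e; have H0 : history M (fun=> u) 0 = [set t | M 0%N t = u].
      apply/seteqP; split => t /=; first exact.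
      by move=> tu k; rewrite leqn0 => /eqP ->.
    have := measure_avoided_le u n 0 (fun=> u); rewrite H0 P0 mul1e.
    apply: le_trans; apply: le_measure; rewrite ?inE.
    - exact: measurableI.
    - by apply: measurableI => //; exact: measurable_avoided.
    - move=> t [Bt tu]; split => // k /andP[k0 _] ku; apply: Bt; by exists k.
  apply: (@subset_measure0 _ _ _ P _ (~` [set t | M 0%N t = u])).
  - exact: measurableD.
  - exact: measurableC.
  - by move=> t [].
  - by apply: etrans (probability_setC P m0) _; rewrite P0 subee.
apply/eqP; rewrite eq_le measure_ge0 andbT.
rewrite -[X in (X <= _)%E]fineK ?fin_num_measure// lee_fin.
rewrite -(cvg_lim (@norm_hausdorff _ _) cvg0); apply: limr_ge.
  by apply/cvg_ex; exists 0.
by apply: nearW => n; rewrite -lee_fin fineK ?fin_num_measure.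
Qed.

End MarkovChain.

(** Foster's criterion, with [f] as Lyapunov function; finite sublevel sets express that [f] tends
    to infinity. *)
Theorem foster_recurrent (R : realType) (V : countType) (G : digraph V)
    (F : seq V) (f : V -> R) :
  (forall v, 0 < outdegree G v)%N ->
  strongly_connected G ->
  (forall v, 0 <= f v) ->
  (forall c, finite_set [set v | f v <= c]) ->
  (forall v, v \notin F -> out_mean G f v < f v) ->
  recurrent (@srw_transition R V G).
Proof.
move=> deg conn f0 ffin fF d T P M u chain.
by apply: return_prob1 => //; exact: cvg_avoid_prob0 f0 ffin fF.
Qed.

(** * Estimates for the iterated logarithm of the quadratic form *)

Section LogarithmEstimates.
Variable R : realType.
Implicit Types a y Q s t : R.

(** Both bounds follow from [t / (1 + t) <= ln (1 + t) <= t], whose left half is the right half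
    taken at [- (t / (1 + t))]. *)
Lemma ln1D_bounds t : `|t| <= 1 / 2 ->
  `|t| / 2 <= `|ln (1 + t)| <= 2 * `|t|.
Proof.
move=> t12; have /andP[tl tr] : - (1 / 2) <= t <= 1 / 2 by rewrite -ler_norml.
have t1 : 0 < 1 + t by lra.
have le_t : ln (1 + t) <= t by apply: le_ln1Dx; lra.
have ge_t : t / (1 + t) <= ln (1 + t).
  have := @le_ln1Dx R (- (t / (1 + t))).
  have -> : 1 + - (t / (1 + t)) = (1 + t)^-1 by field; rewrite gt_eqF.
  rewrite lnV ?posrE// lerN2; apply.
  by rewrite ltrN2 ltr_pdivrMr//; lra.
have [t0|t0] := leP 0 t.
  have t23 : t / 2 <= t / (1 + t).
    by rewrite ler_pdivlMr//; nra.
  rewrite !ger0_norm//; last lra.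
  by apply/andP; split; lra.
have t2 : 2 * t <= t / (1 + t) by rewrite ler_pdivlMr//; nra.
rewrite !ler0_norm; [apply/andP; split; lra|lra|lra].
Qed.

(* With [S = d1 + d2 + d3], the product is
   [L^3 + L^2 S + L (S^2 - (d1^2 + d2^2 + d3^2)) / 2 + d1 d2 d3], and the sum
   of squares, of order [z^4], dominates the other terms. *)
Lemma prod_lt_cube (C L d1 d2 d3 z : R) :
  1 <= C -> 0 < z -> z * C ^+ 3 <= 1 -> 1 <= L -> L * z <= C ->
  `|d1| <= C * z ^+ 2 -> `|d2| <= C * z ^+ 2 -> `|d3| <= C * z ^+ 2 ->
  24 * z ^+ 4 <= d1 ^+ 2 + d2 ^+ 2 + d3 ^+ 2 ->
  `|d1 + d2 + d3| <= C * z ^+ 6 ->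
  (L + d1) * (L + d2) * (L + d3) < L ^+ 3.
Proof.
move=> C1 z0 zC L1 Lz h1 h2 h3 hD hS.
set S := d1 + d2 + d3 in hS; set D := d1 ^+ 2 + d2 ^+ 2 + d3 ^+ 2 in hD.
have -> : (L + d1) * (L + d2) * (L + d3) =
    L ^+ 3 + (L * (L * S + S ^+ 2 / 2 - D / 2) + d1 * d2 * d3).
  by rewrite /S /D; field.
rewrite gtrDl.
have p k : 0 < z ^+ k by rewrite exprn_gt0.
have C0 : 0 < C by lra.
have c k : 1 <= C ^+ k by rewrite exprn_ege1.
have z1 : z <= 1 by apply: le_trans zC; rewrite ler_peMr ?c ?ltW.
have zC2 : z * C ^+ 2 <= 1.
  by apply: le_trans zC; rewrite ler_pM2l// ler_weXn2l.
have z4 := p 4%N.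
have small k x : (4 <= k)%N -> x <= z ^+ k -> x <= z ^+ 4.
  by move=> k4 /le_trans; apply; apply: ler_wiXn2l => //; exact: ltW.
(* Each error term has a surplus factor [z], which absorbs up to [C ^+ 3]. In [L * S] one more
   factor [z] is spent on [L], through [L * z <= C]. *)
have absorb w k : w <= 1 -> w * z ^+ k <= z ^+ k.
  by move=> w1; rewrite ler_piMl// ltW.
have LS : L * S <= z ^+ 4.
  apply: (@le_trans _ _ (L * (C * z ^+ 6))).
    by rewrite ler_pM2l; [exact: le_trans (ler_norm _) hS|lra].
  rewrite (_ : L * _ = (L * z) * (C * z ^+ 5)); last by ring.
  apply: (@le_trans _ _ (C * (C * z ^+ 5))).
    by rewrite ler_pM2r// mulr_gt0.
  rewrite (_ : C * _ = (z * C ^+ 2) * z ^+ 4); [exact: absorb|ring].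
have S2 : S ^+ 2 <= z ^+ 4.
  apply: (@le_trans _ _ ((C * z ^+ 6) ^+ 2)).
    by rewrite -real_normK ?num_real// lerXn2r ?nnegrE// mulr_ge0 ?ltW.
  apply: (@small 11%N) => //.
  rewrite (_ : _ ^+ 2 = (z * C ^+ 2) * z ^+ 11); [exact: absorb|ring].
have d123 : d1 * d2 * d3 <= z ^+ 4.
  apply: (@le_trans _ _ ((C * z ^+ 2) * (C * z ^+ 2) * (C * z ^+ 2))).
    apply: le_trans (ler_norm _) _; rewrite !normrM.
    by rewrite !ler_pM// mulr_ge0.
  apply: (@small 5%N) => //.
  rewrite (_ : _ * _ = (z * C ^+ 3) * z ^+ 5); [exact: absorb|ring].
(* The gain [D / 2 >= 12 * z ^+ 4] outweighs errors of at most [3 / 2 * z ^+ 4]; after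
   multiplication by [L >= 1], what remains still beats [d1 * d2 * d3 <= z ^+ 4]. *)
have neg : L * S + S ^+ 2 / 2 - D / 2 <= - 2 * z ^+ 4 by lra.
suff : L * (L * S + S ^+ 2 / 2 - D / 2) <= - 2 * z ^+ 4 by lra.
by apply: le_trans (_ : L * (- 2 * z ^+ 4) <= _); [rewrite ler_pM2l; lra|nra].
Qed.

(* [p = a / sqrt Q], [q = y / sqrt Q], [z = Q ^ (-1/4)] and [ti = Qi / Q - 1],
   so that [di = ln Qi - ln Q]. *)
Lemma log_increments (p q z t1 t2 t3 : R) :
  p ^+ 2 + 12 * q ^+ 2 = 1 -> 0 < z -> z <= 1 / 8 ->
  t1 = z ^+ 2 * (8 * p + 16 * z ^+ 2) ->
  t2 = z ^+ 2 * (- 4 * p + 24 * q + 16 * z ^+ 2) ->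
  t3 = z ^+ 2 * (- 4 * p - 24 * q + 16 * z ^+ 2) ->
  let d1 := ln (1 + t1) in let d2 := ln (1 + t2) in let d3 := ln (1 + t3) in
  [/\ [/\ `|t1| <= 1 / 2, `|t2| <= 1 / 2 & `|t3| <= 1 / 2],
      [/\ `|d1| <= 56 * z ^+ 2, `|d2| <= 56 * z ^+ 2 & `|d3| <= 56 * z ^+ 2],
      24 * z ^+ 4 <= d1 ^+ 2 + d2 ^+ 2 + d3 ^+ 2 &
      `|d1 + d2 + d3| <= 8 ^+ 5 * z ^+ 6].
Proof.
move=> pq z0 z8 t1E t2E t3E d1 d2 d3.
have p1 : `|p| <= 1 by rewrite ler_norml; apply/andP; split; nra.
have q3 : `|q| <= 1 / 3 by rewrite ler_norml; apply/andP; split; nra.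
have /andP[pl pr] : - 1 <= p <= 1 by rewrite -ler_norml.
have /andP[ql qr] : - (1 / 3) <= q <= 1 / 3 by rewrite -ler_norml.
have zz0 : 0 < z ^+ 2 by rewrite exprn_gt0.
have zz : z ^+ 2 <= 1 / 64 by rewrite expr2; nra.
(* The brackets in [t1], [t2], [t3] are at most 28 = 4 + 24 / 3 + 16 in absolute value, and 28 / 64
   < 1 / 2 permits [ln1D_bounds], which doubles 28 to 56. *)
have bnd w : `|w| <= 28 -> `|z ^+ 2 * w| <= 28 * z ^+ 2.
  by move=> w28; rewrite normrM gtr0_norm// mulrC ler_pM2r.
have b1 : `|t1| <= 28 * z ^+ 2.
  by rewrite t1E; apply: bnd; rewrite ler_norml; apply/andP; split; lra.
have b2 : `|t2| <= 28 * z ^+ 2.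
  by rewrite t2E; apply: bnd; rewrite ler_norml; apply/andP; split; lra.
have b3 : `|t3| <= 28 * z ^+ 2.
  by rewrite t3E; apply: bnd; rewrite ler_norml; apply/andP; split; lra.
have h1 : `|t1| <= 1 / 2 by lra.
have h2 : `|t2| <= 1 / 2 by lra.
have h3 : `|t3| <= 1 / 2 by lra.
have /andP[l1 u1] := ln1D_bounds h1.
have /andP[l2 u2] := ln1D_bounds h2.
have /andP[l3 u3] := ln1D_bounds h3.
split; [by split|by split; lra| |].
  have sq t : `|t| / 2 <= `|ln (1 + t)| -> t ^+ 2 / 4 <= ln (1 + t) ^+ 2.
    move=> h; rewrite -[leRHS]real_normK ?num_real//.
    rewrite -[t ^+ 2]real_normK ?num_real//.
    have := normr_ge0 t; nra.
  have {l1} := sq _ l1; have {l2} := sq _ l2; have {l3} := sq _ l3.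
  (* The linear parts [8 p] and [- 4 p +- 24 q] sum to 0, and their squares sum to
     [96 (p^2 + 12 q^2) = 96]; passing from [ti] to [ln (1 + ti)] costs the factor 4. *)
  have -> : 24 * z ^+ 4 = z ^+ 4 * (96 * (p ^+ 2 + 12 * q ^+ 2)) / 4.
    by rewrite pq; field.
  rewrite -/d1 -/d2 -/d3 => s3 s2 s1.
  have : z ^+ 4 * (96 * (p ^+ 2 + 12 * q ^+ 2)) <=
      t1 ^+ 2 + t2 ^+ 2 + t3 ^+ 2.
    rewrite -subr_ge0 t1E t2E t3E (_ : _ - _ = 3 * 16 ^+ 2 * z ^+ 8).
      by rewrite mulr_ge0// exprn_ge0 ?ltW.
    by ring.
  lra.
have pos t : `|t| <= 1 / 2 -> 1 + t \is Num.pos.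
  by rewrite ler_norml posrE => /andP[? _]; lra.
(* The formula for [Q1 Q2 Q3], divided by [Q^3]. The terms in [z^2] vanish, and those in [z^4]
   cancel because the pairwise products of the linear parts sum to -48, against 3 * 16. *)
have -> : d1 + d2 + d3 =
    ln (1 + z ^+ 6 * (8 ^+ 3 * (8 * z ^+ 6 + p ^+ 3 - 3 / 4 * p))).
  rewrite /d1 /d2 /d3 -!lnM ?pos// ?rpredM ?pos//.
  congr ln; rewrite t1E t2E t3E.
  have q2 : q ^+ 2 = (1 - p ^+ 2) / 12 by lra.
  transitivity ((1 + z ^+ 2 * (8 * p + 16 * z ^+ 2)) *
      ((1 + z ^+ 2 * (- 4 * p + 16 * z ^+ 2)) ^+ 2 -
       24 ^+ 2 * z ^+ 4 * q ^+ 2)); first by ring.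
  by rewrite q2; field.
have z60 : 0 < z ^+ 6 by rewrite exprn_gt0.
have z6 : z ^+ 6 <= (1 / 8) ^+ 6 by apply: lerXn2r => //; rewrite nnegrE; lra.
have m10 : `|8 * z ^+ 6 + p ^+ 3 - 3 / 4 * p| <= 10.
  have p3 : `|p ^+ 3| <= 1 by rewrite normrX exprn_ile1.
  by move: p3; rewrite !ler_norml => /andP[? ?]; apply/andP; split; lra.
set m := _ - _ in m10 *.
have e10 : `|z ^+ 6 * (8 ^+ 3 * m)| <= 8 ^+ 3 * 10 * z ^+ 6.
  rewrite normrM gtr0_norm// mulrC ler_pM2r// normrM ger0_norm// ler_pM2l//.
have /ln1D_bounds/andP[_] : `|z ^+ 6 * (8 ^+ 3 * m)| <= 1 / 2 by lra.
by move=> /le_trans; apply; lra.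
Qed.

(** The shift by 1 keeps the value nonnegative for [x >= 1]. *)
Definition lnln (x : R) : R := ln (1 + ln x).

(** With [L = 1 + ln Q], exponentiating turns the claim into [(L + d1) (L + d2) (L + d3) < L^3],
    which is [prod_lt_cube] fed by [log_increments]. The threshold [8 ^+ 5] is the constant in the
    bound on [d1 + d2 + d3]. *)
Lemma lnln_strictly_superharmonic (C a y : R) : 8 ^+ 5 <= C ->
  C ^+ 12 <= a ^+ 2 + 12 * y ^+ 2 ->
  lnln ((a + 4) ^+ 2 + 12 * y ^+ 2) +
  lnln ((2 - a) ^+ 2 + 12 * (y + 1) ^+ 2) +
  lnln ((2 - a) ^+ 2 + 12 * (y - 1) ^+ 2) <
  3 * lnln (a ^+ 2 + 12 * y ^+ 2).
Proof.
move=> C8; set Q := a ^+ 2 + 12 * y ^+ 2 => CQ.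
have C1 : 8 <= C by lra.
have C0 : 0 < C by lra.
have Q0 : 0 < Q by apply: lt_le_trans CQ; rewrite exprn_gt0.
(* As [s] is the fourth root of [Q], the hypothesis [C ^+ 12 <= Q] becomes [z * C ^+ 3 <= 1] for
   [z = 1 / s]. *)
set s := Num.sqrt (Num.sqrt Q).
have s0 : 0 < s by rewrite !sqrtr_gt0.
have s4 : s ^+ 4 = Q by rewrite (exprM s 2 2) !sqr_sqrtr ?sqrtr_ge0 ?ltW.
have Cs : C ^+ 3 <= s.
  rewrite -(@ler_pXn2r _ 4)// ?nnegrE; [|exact/exprn_ge0/ltW|exact: ltW].
  by rewrite -exprM s4.
pose z := s^-1.
have z0 : 0 < z by rewrite invr_gt0.
have sz : s * z = 1 by rewrite divff// gt_eqF.
have zC : z * C ^+ 3 <= 1 by rewrite mulrC ler_pdivrMr// mul1r.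
have z8 : z <= 1 / 8.
  have C3 : 8 <= C ^+ 3.
    by apply: le_trans C1 _; rewrite -[leLHS]expr1 ler_weXn2l//; lra.
  nra.
pose p := a * z ^+ 2; pose q := y * z ^+ 2.
have aE : a = p * s ^+ 2.
  by rewrite /p -mulrA -exprMn [z * s]mulrC sz expr1n mulr1.
have yE : y = q * s ^+ 2.
  by rewrite /q -mulrA -exprMn [z * s]mulrC sz expr1n mulr1.
have Qz : Q * z ^+ 4 = 1 by rewrite -s4 -exprMn sz expr1n.
have pq : p ^+ 2 + 12 * q ^+ 2 = 1.
  by apply: etrans Qz; rewrite /p /q /Q; ring.
pose t1 := z ^+ 2 * (8 * p + 16 * z ^+ 2).
pose t2 := z ^+ 2 * (- 4 * p + 24 * q + 16 * z ^+ 2).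
pose t3 := z ^+ 2 * (- 4 * p - 24 * q + 16 * z ^+ 2).
have [] := @log_increments p q z t1 t2 t3 pq z0 z8 erefl erefl erefl.
set d1 := ln (1 + t1); set d2 := ln (1 + t2); set d3 := ln (1 + t3).
move=> [h1 h2 h3] [b1 b2 b3] hD hS.
have lnQ x t : `|t| <= 1 / 2 -> x = Q * (1 + t) -> ln x = ln Q + ln (1 + t).
  rewrite ler_norml => /andP[tl _] ->.
  by rewrite lnM ?posrE//; lra.
have sn0 : s != 0 by rewrite gt_eqF.
have lnQ1 : ln ((a + 4) ^+ 2 + 12 * y ^+ 2) = ln Q + d1.
  apply: lnQ => //; transitivity (Q + (8 * a + 16)); first by rewrite /Q; ring.
  by rewrite aE -s4 /t1 /z; field.
have lnQ2 : ln ((2 - a) ^+ 2 + 12 * (y + 1) ^+ 2) = ln Q + d2.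
  apply: lnQ => //; transitivity (Q + (- 4 * a + 24 * y + 16)).
    by rewrite /Q; ring.
  by rewrite aE yE -s4 /t2 /z; field.
have lnQ3 : ln ((2 - a) ^+ 2 + 12 * (y - 1) ^+ 2) = ln Q + d3.
  apply: lnQ => //; transitivity (Q + (- 4 * a - 24 * y + 16)).
    by rewrite /Q; ring.
  by rewrite aE yE -s4 /t3 /z; field.
have s1 : 1 <= s.
  by apply: le_trans Cs; rewrite exprn_ege1//; lra.
have lnQE : ln Q = 4 * ln s by rewrite -s4 lnXn// mulr_natl.
have lns0 := ln_ge0 s1.
(* Since [ln s < s], the left side [(1 + 4 ln s) / s] is below [z + 4]. *)
have Lz : (1 + ln Q) * z <= C.
  have := ln_sublinear s0; rewrite -(ltr_pM2r z0) sz lnQE; lra.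
have zz : z ^+ 2 <= 1 / 64 by rewrite expr2; nra.
have pos d : `|d| <= 56 * z ^+ 2 -> 1 + (ln Q + d) \is Num.pos.
  by rewrite ler_norml posrE lnQE => /andP[? _]; lra.
have z20 : 0 < z ^+ 2 by rewrite exprn_gt0.
have CM d : `|d| <= 56 * z ^+ 2 -> `|d| <= C * z ^+ 2.
  by move=> /le_trans; apply; rewrite ler_pM2r//; lra.
have z60 : 0 < z ^+ 6 by rewrite exprn_gt0.
have L1 : 1 <= 1 + ln Q by rewrite lnQE; lra.
have p1 := pos _ b1; have p2 := pos _ b2; have p3 := pos _ b3.
rewrite /lnln lnQ1 lnQ2 lnQ3 -(lnM p1 p2) -(lnM (rpredM p1 p2) p3).
rewrite mulr_natl -lnXn; last lra.
rewrite ltr_ln ?posrE.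
- rewrite !addrA; apply: (@prod_lt_cube C _ _ _ _ z) => //; try exact: CM.
    lra.
  by apply: le_trans hS _; rewrite ler_pM2r.
- by rewrite -posrE !rpredM.
- by rewrite exprn_gt0//; lra.
Qed.

End LogarithmEstimates.

(** * The alternate lattice: neighbours, strong connectedness and the quadratic form *)

Section AlternateLattice.
Implicit Types (u v : int * int).

Let sgn (y : int) : int := (-1) ^ y.

Lemma alternate_edgeE (a b c e : int) : alternate_lattice (a, b) (c, e) =
  (c == a) && ((e == b + 1) || (e == b - 1)) || (e == b) && (c == a + (-1) ^ b).
Proof. by []. Qed.

Lemma perm_out_nbrs_alternate u :
  perm_eq (out_nbrs alternate_lattice u)
    [:: (u.1 + sgn u.2, u.2); (u.1, u.2 + 1); (u.1, u.2 - 1)].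
Proof.
apply: uniq_perm; first exact: fset_uniq.
  rewrite /= !inE !xpair_eqE -(subr_eq0 (u.2 + 1)) !negb_or !negb_and.
  have sgn0 : sgn u.2 != 0 by rewrite expfz_neq0.
  rewrite -![u.1 + _ == _]subr_eq0 addrAC subrr add0r sgn0 /= andbT.
  by apply/eqP; lia.
case: u => a b [x y]; rewrite in_out_nbrs alternate_edgeE !inE !xpair_eqE.
by rewrite orbC andbC -andb_orr.
Qed.

Lemma outdegree_alternate u : outdegree alternate_lattice u = 3%N.
Proof. exact: perm_size (perm_out_nbrs_alternate u). Qed.

(** Vertical lines are two-way, so moves to the right can be made in row 0 and moves to the left in
    row 1, reached by vertical detours. *)
Lemma alternate_strongly_connected : strongly_connected alternate_lattice.
Proof.
move=> S closed [a b] w Sab.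
have up x y (n : nat) : S (x, y) -> S (x, y + n%:Z).
  elim: n => [|n IH] Sxy; first by rewrite addr0.
  apply: closed (IH Sxy) _; rewrite alternate_edgeE eqxx andTb.
  by apply/orP; left; apply/orP; left; apply/eqP; lia.
have down x y (n : nat) : S (x, y) -> S (x, y - n%:Z).
  elim: n => [|n IH] Sxy; first by rewrite subr0.
  apply: closed (IH Sxy) _; rewrite alternate_edgeE eqxx andTb.
  by apply/orP; left; apply/orP; right; apply/eqP; lia.
have vert x y z : S (x, y) -> S (x, z).
  move=> Sxy; have [yz|zy] := leP y z.
    by have := up x y `|z - y|%N Sxy; congr (S (_, _)); lia.
  by have := down x y `|z - y|%N Sxy; congr (S (_, _)); lia.
have right x y (n : nat) : S (x, y) -> S (x + n%:Z, y).
  move=> Sxy; apply: (vert _ 0); elim: n => [|n IH].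
    by rewrite addr0; exact: vert Sxy.
  apply: closed IH _; rewrite alternate_edgeE eqxx expr0z.
  by apply/orP; right; apply/eqP; lia.
have left x y (n : nat) : S (x, y) -> S (x - n%:Z, y).
  move=> Sxy; apply: (vert _ 1); elim: n => [|n IH].
    by rewrite subr0; exact: vert Sxy.
  apply: closed IH _; rewrite alternate_edgeE eqxx expr1z.
  by apply/orP; right; apply/eqP; lia.
case: w => c e; apply: (vert _ b); have [ac|ca] := leP a c.
  by have := right a b `|c - a|%N Sab; congr (S (_, _)); lia.
by have := left a b `|c - a|%N Sab; congr (S (_, _)); lia.
Qed.

(** This is [4 e] times the martingale [x + e / 4], an integer because [e^2 = 1]. *)
Definition alternate_coord u : int := 4 * ((-1) ^ u.2 * u.1) + 1.

Definition alternate_norm u : int := alternate_coord u ^+ 2 + 12 * u.2 ^+ 2.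

Lemma sgn_pm1 y : sgn y = 1 \/ sgn y = -1.
Proof.
have pm1 n : (-1 : int) ^+ n = 1 \/ (-1 : int) ^+ n = -1.
  by rewrite -signr_odd; case: (odd n); [right|left].
rewrite /sgn; case: y => n; first exact: pm1.
by rewrite /exprz; case: (pm1 n.+1) => ->; rewrite ?invr1 ?invrN1; tauto.
Qed.

Lemma sgnD1 y : sgn (y + 1) = - sgn y.
Proof. by rewrite /sgn exprzDr ?unitrN1// expr1z mulrN1. Qed.

Lemma sgnB1 y : sgn (y - 1) = - sgn y.
Proof. by rewrite -[in RHS](subrK 1 y) sgnD1 opprK. Qed.

Lemma alternate_coord_horizontal x y :
  alternate_coord (x + (-1) ^ y, y) = alternate_coord (x, y) + 4.
Proof.
by rewrite /alternate_coord /= -/(sgn y); case: (sgn_pm1 y) => ->; ring.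
Qed.

Lemma alternate_coord_up x y :
  alternate_coord (x, y + 1) = 2 - alternate_coord (x, y).
Proof. by rewrite /alternate_coord /= -!/(sgn _) sgnD1; ring. Qed.

Lemma alternate_coord_down x y :
  alternate_coord (x, y - 1) = 2 - alternate_coord (x, y).
Proof. by rewrite /alternate_coord /= -!/(sgn _) sgnB1; ring. Qed.

(** An integer of the form [4 n + 1] is nonzero, so its square is at least 1. *)
Lemma alternate_norm_ge1 u : 1 <= alternate_norm u.
Proof.
rewrite /alternate_norm /alternate_coord.
have h : 0 <= u.2 ^+ 2 by rewrite sqr_ge0.
set n : int := _ * u.1.
have : 0 <= (4 * n + 1) ^+ 2 by rewrite sqr_ge0.
nia.
Qed.

Lemma finite_alternate_norm_le (R : realType) (K : R) :
  finite_set [set u | (alternate_norm u)%:~R <= K].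
Proof.
have [n nK] : exists n : nat, K <= n%:R.
  by exists (Num.truncn K).+1; apply: ltW; exact: truncnS_gt.
(* The form bounds [(4 e x + 1)^2] and [12 y^2] by [n], so both coordinates lie between [- (n + 1)]
   and [n + 1]; [r] lists this interval. *)
have [r rP] : exists r : seq int, forall x : int, `|x| <= n.+1%:Z -> x \in r.
  exists [seq k%:Z - n.+1%:Z | k <- iota 0 (n.+1.*2.+1)] => x xn.
  apply/mapP; exists (absz (x + n.+1%:Z)); last by lia.
  by rewrite mem_iota; lia.
apply: (@sub_finite_set _ _ [set` [seq (x, y) | x <- r, y <- r]]);
  last exact: finite_seq.
move=> [x y] /= xyK.
have : alternate_norm (x, y) <= n%:Z.
  by rewrite -(ler_int R); exact: le_trans nK.
rewrite /alternate_norm /alternate_coord /= => h.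
apply/allpairs_f; apply: rP.
  by case: (sgn_pm1 y) => sy; move: h; rewrite -/(sgn y) sy; nia.
have := sqr_ge0 (4 * ((-1) ^ y * x) + 1); nia.
Qed.

End AlternateLattice.

(** * Foster's criterion applied to the alternate lattice *)

Theorem theorem2p7 (R : realType) :
  recurrent (@srw_transition R _ alternate_lattice).
Proof.
pose Q u : R := (alternate_norm u)%:~R.
have Q1 u : 1 <= Q u by rewrite /Q (ler_int _ 1) alternate_norm_ge1.
have lnQ0 u : 0 <= ln (Q u) := ln_ge0 (Q1 u).
(* The least constant that [lnln_strictly_superharmonic] accepts; the exceptional set is then the
   finite sublevel set [Q <= C ^+ 12]. *)
pose C : R := 8 ^+ 5.
have finQ (K : R) : finite_set [set u | Q u <= K] := finite_alternate_norm_le K.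
apply: (@foster_recurrent _ _ _ (fset_set [set u | Q u <= C ^+ 12])
  (fun u => lnln (Q u))).
- by move=> u; rewrite outdegree_alternate.
- exact: alternate_strongly_connected.
- by move=> u; apply: ln_ge0; rewrite lerDl.
(* From [ln (1 + ln Q) <= c] follows [ln Q <= expR c], hence [Q <= expR (expR c)]. *)
- move=> c; apply: sub_finite_set (finQ (expR (expR c))) => u /= h.
  rewrite -[leLHS]lnK ?posrE ?(lt_le_trans _ (Q1 u))// ler_expR.
  have L0 : 0 < 1 + ln (Q u) by have := lnQ0 u; lra.
  have : 1 + ln (Q u) <= expR c by rewrite -[leLHS]lnK ?posrE// ler_expR.
  lra.
move=> [x y]; rewrite in_fset_set// => /negP; rewrite inE /= => /negP.
rewrite -ltNge => CQ.
rewrite /out_mean outdegree_alternate (perm_big _ (perm_out_nbrs_alternate _)).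
rewrite !big_cons big_nil /= addr0 addrA ltr_pdivrMr// mulrC.
pose a : R := (alternate_coord (x, y))%:~R.
have QE u : Q u = (alternate_coord u)%:~R ^+ 2 + 12 * u.2%:~R ^+ 2.
  by rewrite /Q /alternate_norm rmorphD rmorphM !rmorphXn.
have CQ' : C ^+ 12 <= a ^+ 2 + 12 * y%:~R ^+ 2.
  by rewrite -(QE (x, y)); exact: ltW.
have := lnln_strictly_superharmonic (lexx C) CQ'.
rewrite !QE /= alternate_coord_horizontal alternate_coord_up.
by rewrite alternate_coord_down (intrD _ _ 4)
  (intrB _ 2) (intrD _ y) (intrB _ y).
Qed.
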